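(* Assume the following (all notation is as defined in the context). The functions $f,h,l$ are proper lower semicontinuous convex, $f$ is Fréchet differentiable with Lipschitz continuous gradient, and $l$ is strongly convex in the sense that its conjugate $l^*$ is Fréchet differentiable with Lipschitz continuous gradient; the operators $\mathbf P$ and $\mathbf M_1$ are positive definite; the iteration (I) has at least one fixed point; and there is $\beta>0$ such that for every fixed point $(\mathbf x^\star,\mathbf s^\star)$ of (I), every $\mathbf x\in\mathcal X$ and every $\mathbf s\in\mathcal S$, $$\langle \mathbf x-\mathbf x^\star,\nabla f(\mathbf x)-\nabla f(\mathbf x^\star)\rangle\ \ge\ \beta\|\nabla f(\mathbf x)-\nabla f(\mathbf x^\star)\|^2_{\mathbf P^{-1}},$$ $$\langle \mathbf s-\mathbf s^\star,\nabla l^*(\mathbf s)-\nabla l^*(\mathbf s^\star)\rangle\ \ge\ \beta\|\nabla l^*(\mathbf s)-\nabla l^*(\mathbf s^\star)\|^2_{\mathbf M_1^{-1}}.$$ Let $\theta\in(3/4,1]$ and $\tau\in(0,2\beta)$, and let $\{(\mathbf x^k,\mathbf s^k)\}$ be a sequence generated by (I). Then $\{(\mathbf x^k,\mathbf s^k)\}$ converges weakly to a fixed point of (I). If, moreover, the iteration (I), regarded as an operator on $\mathcal X\times\mathcal S$, is demicompact at $\mathbf 0$, then the sequence converges strongly.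
   Context: $\mathcal X$ and $\mathcal S$ are real Hilbert spaces; $f:\mathcal X\to(-\infty,+\infty]$ and $h,l:\mathcal S\to(-\infty,+\infty]$; $h^*,l^*$ are the Legendre–Fenchel conjugates and $\partial h^*$ is the convex subdifferential. $\mathbf A:\mathcal X\to\mathcal S$ is a bounded linear operator with adjoint $\mathbf A^\top$. $\mathbf P$ on $\mathcal X$ and $\mathbf D$ on $\mathcal S$ are bounded self-adjoint linear operators, and $\tau,\sigma>0$, $\theta\in(3/4,1]$ are parameters. ''Positive definite'' means bounded, self-adjoint and bounded below by a positive multiple of the identity (hence boundedly invertible). Define $$\mathbf M=\tfrac{\tau}{\sigma}(\mathbf D-\tau\sigma\mathbf A\mathbf P^{-1}\mathbf A^\top),\quad \mathbf M_1=\tfrac{\tau}{\sigma}(\mathbf D-\theta\tau\sigma\mathbf A\mathbf P^{-1}\mathbf A^\top)$$ ($\mathbf M$ need not be positive semidefinite). For a self-adjoint operator $\mathbf Q$, $\|\mathbf v\|^2_{\mathbf Q}:=\langle \mathbf v,\mathbf Q\mathbf v\rangle$. Iteration (I): given $(\mathbf x^k,\mathbf s^k)\in\mathcal X\times\mathcal S$, $$\mathbf s^{k+1}=(\mathbf D+\sigma\partial h^* )^{-1}\Big(\tfrac{\sigma}{\tau}\mathbf M\mathbf s^k+\sigma\mathbf A\big(\mathbf x^k-\tau\mathbf P^{-1}\nabla f(\mathbf x^k)\big)-\sigma\nabla l^*(\mathbf s^k)\Big),$$ $$\mathbf x^{k+1}=\mathbf x^k-\tau\mathbf P^{-1}\nabla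 f(\mathbf x^k)-\tau\mathbf P^{-1}\mathbf A^\top\mathbf s^{k+1}.$$ A fixed point of (I) is a pair $(\mathbf x^\star,\mathbf s^\star)$ that (I) maps to itself. An operator $T$ on a Hilbert space $\mathcal H$ is demicompact at $\mathbf v\in\mathcal H$ if for every bounded sequence $\{\mathbf v^k\}_{k\ge0}$ in $\mathcal H$ such that $T\mathbf v^k-\mathbf v^k\to\mathbf v$ strongly, there exists a strongly convergent subsequence of $\{\mathbf v^k\}$. *)

(* Defs.v *)
From HB Require Import structures.
From mathcomp Require Import all_boot all_order all_algebra.
From mathcomp Require Import sesquilinear.
From mathcomp Require Import all_classical all_reals all_analysis.

Set Implicit Arguments.
Unset Strict Implicit.
Unset Printing Implicit Defensive.

Import Order.TTheory GRing.Theory Num.Theory.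
Import numFieldNormedType.Exports.

Local Open Scope classical_set_scope.
Local Open Scope ring_scope.

(* A real Hilbert space: a complete normed module whose norm is induced by a
   symmetric, bilinear, positive definite form. *)
HB.mixin Record isHilbert (R : realType) E of CompleteNormedModule R E := {
  dotp : {dot E for idfun} ;
  dotp_norm : forall x : E, dotp x x = `|x| ^+ 2
}.

#[short(type="hilbertType")]
HB.structure Definition Hilbert (R : realType) :=
  {E of isHilbert R E & CompleteNormedModule R E}.

Section operators.
Context {R : realType}.

Definition bounded_op {E F : hilbertType R} (Q : E -> F) : Prop :=
  exists M : R, forall x, `|Q x| <= M * `|x|.

Definition self_adjoint {E : hilbertType R} (Q : E -> E) : Prop :=
  forall x y : E, dotp (Q x) y = dotp x (Q y).

(* Linearity is not listed: it follows from self-adjointness. *)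
Definition pos_def {E : hilbertType R} (Q : E -> E) : Prop :=
  [/\ bounded_op Q, self_adjoint Q &
      exists2 c : R, 0 < c & forall x : E, c * `|x| ^+ 2 <= dotp x (Q x)].

(* The value at [s] is the vector provided (uniquely) by the Riesz
   representation theorem when [A] is a bounded linear operator. *)
Definition adjoint {E F : hilbertType R} (A : E -> F) (s : F) : E :=
  xget 0 [set y : E | forall x : E, dotp (A x) s = dotp x y].

(* The two-sided inverse of [Q] when [Q] is bijective, e.g. positive
   definite; unspecified otherwise. *)
Definition inv_op {E : hilbertType R} (Q : E -> E) : E -> E :=
  pinv [set: E] Q.

(* The squared (semi)norm; it may be negative when [Q] is not positive. *)
Definition sqnorm {E : hilbertType R} (Q : E -> E) (v : E) : R :=
  dotp v (Q v).

End operators.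

Section convex_analysis.
Context {R : realType} {E : hilbertType R}.
Implicit Types (g : E -> \bar R) (x y v : E).

Definition proper g : Prop :=
  (forall x, g x != -oo%E) /\ exists x, g x != +oo%E.

(* To be used for functions with values in ]-oo, +oo], so that no sum
   [+oo + -oo] occurs. *)
Definition econvex g : Prop :=
  forall x y (t : R), 0 < t < 1 ->
    (g (t *: x + (1 - t) *: y)%R <= t%:E * g x + (1 - t)%:E * g y)%E.

Definition proper_lsc_convex g : Prop :=
  [/\ proper g, lower_semicontinuous g & econvex g].

(* The Legendre-Fenchel conjugate, the dual of [E] being identified with [E]. *)
Definition conjugate g : E -> \bar R :=
  fun u => ereal_sup [set ((dotp y u)%:E - g y)%E | y in [set: E]].

(* Empty outside the effective domain of [g]. *)
Definition subdiff g x : set E :=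
  [set q | g x \is a fin_num /\
           forall y, (g x + (dotp (y - x)%R q)%:E <= g y)%E].

(* Frechet differentiability on the whole space; in particular [g] is
   everywhere finite. *)
Definition frechet_differentiable g : Prop :=
  (forall x, g x \is a fin_num) /\
  (forall x, differentiable (fine \o g) x).

(* The Riesz representative of the Frechet derivative. *)
Definition grad g x : E :=
  xget 0 [set w : E | forall v, 'd (fine \o g) x v = dotp w v].

Definition smooth g : Prop := frechet_differentiable g /\ lipschitz (grad g).

End convex_analysis.

(* The set-valued inverse of [D + sigma * dg], [dg] the subdifferential. *)
Definition resolvent {R : realType} {E : hilbertType R} (D : E -> E)
    (sigma : R) (g : E -> \bar R) (u : E) : set E :=
  [set s | exists2 q, subdiff g s q & u = D s + sigma *: q].

Section iteration.
Context {R : realType} {X S : hilbertType R}.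
Variables (f : X -> \bar R) (h l : S -> \bar R) (A : X -> S).
Variables (P : X -> X) (D : S -> S) (tau sigma : R).

(* [opM 1] is the operator M, and [opM theta] is M_1. *)
Definition opM (theta : R) (s : S) : S :=
  (tau / sigma) *:
    (D s - (theta * tau * sigma) *: A (inv_op P (adjoint A s))).

(* [iterI z z'] says that one step of the iteration leads from [z] to [z'];
   the equation s' = (D + sigma dh^* )^-1 (u) is read as membership in the
   set-valued inverse, which has at most one element when D is positive
   definite. *)
Definition iterI (z : X * S) : set (X * S) :=
  [set z' |
    let: (x, s) := z in let: (x', s') := z' in
    resolvent D sigma (conjugate h)
      ((sigma / tau) *: opM 1 s
       + sigma *: A (x - tau *: inv_op P (grad f x))
       - sigma *: grad (conjugate l) s) s' /\
    x' = x - tau *: inv_op P (grad f x) - tau *: inv_op P (adjoint A s')].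

Definition iterI_fixed (z : X * S) : Prop := iterI z z.

Definition iterI_op (z : X * S) : X * S := xget 0 (iterI z).

End iteration.

(* Weak convergence in the Hilbert space X * S, whose inner product is the sum
   of those of the factors. *)
Definition weak_cvg {R : realType} {X S : hilbertType R}
    (z : nat -> X * S) (z0 : X * S) : Prop :=
  forall w : X * S,
    dotp (z k).1 w.1 + dotp (z k).2 w.2 @[k --> \oo]
      --> dotp z0.1 w.1 + dotp z0.2 w.2.

(* Stated for normed modules because the product X * S carries the sup norm,
   which is equivalent to its Hilbert norm: bounded and strongly convergent
   sequences are the same for both. *)
Definition demicompact {R : realType} {E : normedModType R}
    (T : E -> E) (v : E) : Prop :=
  forall u : nat -> E, bounded_fun u ->
    T (u k) - u k @[k --> \oo] --> v ->
    exists2 phi : nat -> nat, increasing_seq phi & cvgn (u \o phi).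

(* Main.v *)
Require Import Defs.
From HB Require Import structures.
From mathcomp Require Import all_boot all_order all_algebra.
From mathcomp Require Import sesquilinear.
From mathcomp Require Import all_classical all_reals all_analysis.
From mathcomp Require Import ring lra.

Set Implicit Arguments.
Unset Strict Implicit.
Unset Printing Implicit Defensive.

Import Order.TTheory GRing.Theory Num.Theory.
Import numFieldNormedType.Exports.

Local Open Scope classical_set_scope.
Local Open Scope ring_scope.

(** Write G for the inverse of P, B for the adjoint of A, K = A G B, and
    M(t) = (tau / sigma) D - t tau^2 K, so that M = M(1) in the iteration and
    M(theta) is the operator that is assumed positive definite.

    Eliminating the resolvent, one step from (x, s) to (x', s') says that
    A x' - grad l* s + (M s - M s') / tau is a subgradient of h* at s' and that
    x' = x - tau G (grad f x + B s') ([stepE]).  Subtracting the system of a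
    fixed point (x0, s0) and using monotonicity of the subdifferential together
    with the two cocoercivity inequalities gives a decrease of
    |x - x0|_P^2 + |s - s0|_M^2, which is useless by itself since M may fail to
    be positive.  However, the
    decrease contains the whole square of b' = tau B (s' - s0), so part of it can
    be traded: with b = tau B (s - s0), all norms of b and b' being those of G,
    adding (theta - 1/2) |b|^2 to the energy that uses M(theta) leaves in the
    decrease the quadratic form
      (theta - 1/2) (|b|^2 + |b'|^2) + 2 (1 - theta) <b, b'>,
    which is positive definite exactly when theta > 3/4.  The resulting energy is
    |x - x0|_P^2 + |s - s0|^2 in the metric of M(1/2) ([energy_decrease]): both
    metrics are positive definite, and the iterates are Fejer monotone with
    respect to the set of fixed points ([fejer_step]).

    Summing the decrease, grad f x_k, grad l* s_k and B s_k converge strongly to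
    their values at a fixed point, and consecutive iterates get close.  This is
    enough to identify weak limit points: gradients of convex functions are
    demiclosed, and in the subgradient inequality of h* the only product of two
    weakly convergent sequences is <s_k, A x_k> = <B s_k, x_k>, where one factor
    converges strongly ([weak_limit_fixed]).  Opial's argument then gives weak
    convergence ([opial]).

    Weak limits are taken along ultrafilters instead of subsequences: along an
    ultrafilter every bounded scalar sequence converges, so the Riesz theorem
    alone produces a weak limit ([ultra_weak_cvg]).

    Under demicompactness some subsequence converges strongly, necessarily to the
    weak limit, so the energy relative to that fixed point tends to 0 along the
    subsequence and, being monotone, along the whole sequence. *)

(** * Inner products *)

Section inner_product.
Context {R : realType} {E : hilbertType R}.
Implicit Types (x y v w : E) (a b : R).

Lemma dotpC x y : dotp x y = dotp y x.
Proof. by rewrite (hermC (dotp : {dot E for idfun}) x y) expr0 mul1r. Qed.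

Lemma dotpDl x y v : dotp (x + y) v = dotp x v + dotp y v.
Proof. exact: linearDl. Qed.

Lemma dotpZl a x v : dotp (a *: x) v = a * dotp x v.
Proof. by have := linearZl_LR (dotp : {dot E for idfun}) v a x. Qed.

Lemma dotpNl x v : dotp (- x) v = - dotp x v.
Proof. by rewrite -scaleN1r dotpZl mulN1r. Qed.

Lemma dotpBl x y v : dotp (x - y) v = dotp x v - dotp y v.
Proof. by rewrite dotpDl dotpNl. Qed.

Lemma dotpDr x y v : dotp v (x + y) = dotp v x + dotp v y.
Proof. by rewrite !(dotpC v) dotpDl. Qed.

Lemma dotpZr a x v : dotp v (a *: x) = a * dotp v x.
Proof. by rewrite !(dotpC v) dotpZl. Qed.

Lemma dotpNr x v : dotp v (- x) = - dotp v x.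
Proof. by rewrite !(dotpC v) dotpNl. Qed.

Lemma dotpBr x y v : dotp v (x - y) = dotp v x - dotp v y.
Proof. by rewrite !(dotpC v) dotpBl. Qed.

Lemma dotp0l v : dotp 0 v = 0.
Proof. by rewrite -(scale0r 0) dotpZl mul0r. Qed.

Lemma dotp0r v : dotp v 0 = 0.
Proof. by rewrite dotpC dotp0l. Qed.

Definition dotpE := (dotpDl, dotpDr, dotpBl, dotpBr, dotpZl, dotpZr,
  dotpNl, dotpNr, dotp0l, dotp0r).

Lemma cauchy_schwarz x y : `|dotp x y| <= `|x| * `|y|.
Proof.
have [->|y0] := eqVneq y 0; first by rewrite dotp0r !normr0 mulr0.
have yy : 0 < `|y| ^+ 2 by rewrite exprn_gt0 ?normr_gt0.
have := sqr_ge0 `|(`|y| ^+ 2) *: x - dotp x y *: y|.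
rewrite -dotp_norm !dotpE !dotp_norm (dotpC y x) => H.
rewrite -(ler_pXn2r (n := 2)) ?nnegrE ?mulr_ge0 // exprMn real_normK ?num_real //.
rewrite -(ler_pM2l yy); nra.
Qed.

Lemma dotp_inj x y : (forall v, dotp x v = dotp y v) -> x = y.
Proof.
move=> xy; apply/eqP; rewrite -subr_eq0 -normr_eq0 -sqrf_eq0 -dotp_norm.
by rewrite dotpBl xy subrr.
Qed.

Lemma bounded_op_gt0 {F : hilbertType R} (Q : E -> F) : bounded_op Q ->
  exists2 M, 0 < M & forall x, `|Q x| <= M * `|x|.
Proof.
move=> [M QM]; exists (`|M| + 1) => [|x]; first by rewrite ltr_wpDl.
apply: le_trans (QM x) _; rewrite ler_wpM2r // ler_wpDr //; exact: ler_norm.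
Qed.

End inner_product.

(** * Weak and strong convergence along a filter *)

Section dotp_cvg.
Context {R : realType} {E : hilbertType R} {T : Type} {F : set_system T}.
Context {FF : Filter F}.
Implicit Types (u v : T -> E) (w : E).

Lemma cvg_dotp_bounded0 u v B : (forall k, `|u k| <= B) ->
  v k @[k --> F] --> 0 -> dotp (u k) (v k) @[k --> F] --> 0.
Proof.
move=> uB v0; apply: norm_cvg0.
apply: (@squeeze_cvgr _ F _ R (cst 0) (fun k => B * `|v k|)).
- apply: nearW => k; rewrite normr_ge0 /=; apply: le_trans (cauchy_schwarz _ _) _.
  by rewrite ler_wpM2r.
- exact: cvg_cst.
- rewrite -(mulr0 B); apply: cvgM; first exact: cvg_cst.
  by rewrite -(@normr0 _ E); exact: cvg_norm.
Qed.

(** A product of a weakly and a strongly convergent sequence passes to the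
    limit; boundedness is assumed because it does not follow from weak
    convergence along an arbitrary filter. *)
Lemma cvg_dotp_weak_strong u v B (ul vl : E) : (forall k, `|u k| <= B) ->
  (forall w, dotp (u k) w @[k --> F] --> dotp ul w) ->
  v k @[k --> F] --> vl ->
  dotp (u k) (v k) @[k --> F] --> dotp ul vl.
Proof.
move=> uB uw vs; rewrite -[X in _ --> X]addr0.
have -> : (fun k => dotp (u k) (v k)) =
    (fun k => dotp (u k) vl + dotp (u k) (v k - vl)).
  by apply/funext => k; rewrite dotpBr addrC subrK.
apply: cvgD; first exact: uw.
apply: cvg_dotp_bounded0 uB _; rewrite -(subrr vl); apply: cvgB => //.
exact: cvg_cst.
Qed.

Lemma cvg_dotpl u (l w : E) : u k @[k --> F] --> l ->
  dotp (u k) w @[k --> F] --> dotp l w.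
Proof.
move=> ul; rewrite dotpC; under eq_fun do rewrite dotpC.
by apply: (@cvg_dotp_weak_strong (cst w) u `|w|) => // v; exact: cvg_cst.
Qed.

End dotp_cvg.

Section bounded_op_cvg.
Context {R : realType} {E1 E2 : hilbertType R}.

Lemma bounded_op_cvg0 {T : Type} {F : set_system T} {FF : Filter F}
    (L : E1 -> E2) (u : T -> E1) : bounded_op L ->
  u k @[k --> F] --> 0 -> L (u k) @[k --> F] --> 0.
Proof.
move=> [c Lc] u0; apply: norm_cvg0.
apply: (@squeeze_cvgr _ F _ R (cst 0) (fun k => c * `|u k|)).
- by apply: nearW => k; rewrite normr_ge0 /=; exact: Lc.
- exact: cvg_cst.
- rewrite -(mulr0 c); apply: cvgM; first exact: cvg_cst.
  by rewrite -(@normr0 _ E1); exact: cvg_norm.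
Qed.

Lemma sqnorm_cvg0 {T : Type} {F : set_system T} {FF : Filter F}
    (Q : E1 -> E1) (u : T -> E1) : bounded_op Q ->
  u k @[k --> F] --> 0 -> sqnorm Q (u k) @[k --> F] --> 0.
Proof.
move=> [c Qc] u0; apply: norm_cvg0.
have nu0 : `|u k| @[k --> F] --> (0 : R).
  by rewrite -(@normr0 _ E1); exact: cvg_norm.
apply: (@squeeze_cvgr _ F _ R (cst 0) (fun k => `|u k| * (c * `|u k|))).
- apply: nearW => k; rewrite normr_ge0 /=; apply: le_trans (cauchy_schwarz _ _) _.
  by rewrite ler_wpM2l.
- exact: cvg_cst.
- rewrite -[X in _ --> X](mul0r (c * 0)); apply: cvgM => //; apply: cvgM => //.
  exact: cvg_cst.
Qed.

Lemma weak_cvg_shift {T : Type} {F : set_system T} {FF : Filter F}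
    (u v : T -> E1) (ul : E1) :
  (forall w, dotp (u k) w @[k --> F] --> dotp ul w) ->
  u k - v k @[k --> F] --> 0 ->
  forall w, dotp (v k) w @[k --> F] --> dotp ul w.
Proof.
move=> uw uv w; rewrite -[X in _ --> X]subr0 -(dotp0l w).
have -> : (fun k => dotp (v k) w) = (fun k => dotp (u k) w - dotp (u k - v k) w).
  by apply/funext => k; rewrite dotpBl opprB addrC subrK.
by apply: cvgB; [exact: uw|exact: cvg_dotpl].
Qed.

End bounded_op_cvg.

(** * Riesz representation, inverses and adjoints *)

Section pos_def.
Context {R : realType} {E : hilbertType R}.
Implicit Types (Q : E -> E) (x y v w : E).

Lemma self_adjointD Q : self_adjoint Q -> {morph Q : x y / x + y}.
Proof. by move=> Qs x y; apply: dotp_inj => v; rewrite !(Qs, dotpE). Qed.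

Lemma self_adjointZ Q a : self_adjoint Q -> {morph Q : x / a *: x}.
Proof. by move=> Qs x; apply: dotp_inj => v; rewrite !(Qs, dotpE). Qed.

Lemma self_adjointB Q : self_adjoint Q -> {morph Q : x y / x - y}.
Proof. by move=> Qs x y; apply: dotp_inj => v; rewrite !(Qs, dotpE). Qed.

Lemma self_adjointN Q : self_adjoint Q -> {morph Q : x / - x}.
Proof. by move=> Qs x; apply: dotp_inj => v; rewrite !(Qs, dotpE). Qed.

Lemma self_adjointC Q x y : self_adjoint Q -> dotp y (Q x) = dotp x (Q y).
Proof. by move=> Qs; rewrite -Qs dotpC. Qed.

(** The Lax-Milgram theorem for a symmetric form: x minimises
    <x, Q x> - 2 phi x.  With Q the identity this is the Riesz representation
    theorem, and with phi an inner product it is the surjectivity of Q.  The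
    optimality condition passes to the limit because self-adjointness moves Q to
    the fixed vector y. *)
Lemma coercive_riesz Q (c : R) (phi : E -> R) (K : R) : self_adjoint Q -> 0 < c ->
  (forall x, c * `|x| ^+ 2 <= dotp x (Q x)) ->
  {morph phi : x y / x + y} -> (forall a x, phi (a *: x) = a * phi x) ->
  (forall x, `|phi x| <= K * `|x|) ->
  exists x, forall y, phi y = dotp (Q x) y.
Proof.
move=> Qs c0 Qc phiD phiZ phiK.
pose J x := dotp x (Q x) - 2 * phi x.
have J_lb x : - (K ^+ 2 / c) <= J x.
  have := Qc x; have := phiK x; have := ler_norm (phi x); rewrite /J => h1 h2 h3.
  have : 0 <= (c * `|x| - K) ^+ 2 / c by rewrite divr_ge0 ?sqr_ge0 // ltW.
  have -> : (c * `|x| - K) ^+ 2 / c = c * `|x| ^+ 2 - 2 * (K * `|x|) + K ^+ 2 / c.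
    by field; rewrite gt_eqF.
  lra.
have J_inf : has_inf (range J).
  by split; [exists (J 0), 0|exists (- (K ^+ 2 / c)) => _ [x _ <-]].
pose m := inf (range J).
have mJ x : m <= J x by apply: ge_inf; [case: J_inf|exists x].
have Hx n : exists x, J x < m + n.+1%:R^-1.
  have e0 : (0 : R) < n.+1%:R^-1 by rewrite invr_gt0.
  by have [_ [x _ <-] xn] := inf_adherent e0 J_inf; exists x.
have [u uP] := choice Hx.
(* Parallelogram identity: J is at least m at the midpoint, so two
   near-minimisers are close. *)
have uu n k : `|u n - u k| ^+ 2 <= 2 / c * (n.+1%:R^-1 + k.+1%:R^-1).
  have := mJ (2^-1 *: (u n + u k)); have := uP n; have := uP k.
  have := Qc (u n - u k).
  rewrite /J !(self_adjointD Qs, self_adjointN Qs, self_adjointZ _ Qs, phiZ, phiD, dotpE).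
  rewrite (self_adjointC (u n) (u k) Qs) => h1 h2 h3 h4.
  rewrite -(ler_pM2l c0).
  have -> r : c * (2 / c * r) = 2 * r by field; rewrite gt_eqF.
  move: h1 h2 h3 h4; move: (n.+1%:R^-1) (k.+1%:R^-1) => a b *.
  lra.
have [x ux] : exists x, u n @[n --> \oo] --> x.
  suff : cvgn u by move=> uc; exists (limn u).
  apply/cauchy_cvgP/cauchy_exP => e e0.
  have e1 : 0 < c * e ^+ 2 / 4 by rewrite divr_gt0 // mulr_gt0 // exprn_gt0.
  have [N _ HN] := near_infty_natSinv_lt (PosNum e1).
  exists (u N), N => // n /= Nn; rewrite -ball_normE /=.
  rewrite -(ltr_pXn2r (n := 2)) ?nnegrE ?(ltW e0) //.
  apply: le_lt_trans (uu _ _) _.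
  have := HN N (leqnn N); have := HN n Nn => /= h1 h2.
  rewrite mulrAC ltr_pdivrMr //.
  move: h1 h2; move: (n.+1%:R^-1) (N.+1%:R^-1) => a b *; lra.
exists x => y.
set b := dotp y (Q y); set a := phi y - dotp (Q x) y.
have b0 : 0 <= b by rewrite (le_trans _ (Qc y)) // mulr_ge0 ?sqr_ge0 // ltW.
(* J (u n + t y) >= m > J (u n) - 1 / (n + 1), in the limit: a quadratic
   polynomial in t without constant term is nonnegative, which forces a = 0. *)
have at0 t : 0 <= t ^+ 2 * b - 2 * t * a.
  have lim : n.+1%:R^-1 + (t ^+ 2 * b - 2 * t * (phi y - dotp (u n) (Q y))) @[n --> \oo]
      --> 0 + (t ^+ 2 * b - 2 * t * a).
    apply: cvgD; first exact: cvg_harmonic.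
    apply: cvgB; first exact: cvg_cst.
    apply: cvgM; first exact: cvg_cst.
    rewrite /a Qs; apply: cvgB; [exact: cvg_cst|exact: cvg_dotpl].
  rewrite -[leRHS]add0r; apply: (cvgr_to_ge lim); near=> n.
  have := mJ (u n + t *: y); have := uP n.
  rewrite /J !(self_adjointD Qs, self_adjointZ _ Qs, phiZ, phiD, dotpE) -/b.
  rewrite (self_adjointC (u n) y Qs).
  move: (n.+1%:R^-1) => c' *; lra.
(* The polynomial is minimal at a / b, but b may vanish. *)
have := at0 (a / (b + 1)).
have -> : (a / (b + 1)) ^+ 2 * b - 2 * (a / (b + 1)) * a =
  - (a ^+ 2 * ((b + 2) / (b + 1) ^+ 2)) by field; rewrite gt_eqF ?ltr_wpDl.
rewrite oppr_ge0 pmulr_lle0 ?divr_gt0 ?exprn_gt0 ?ltr_wpDl // => a0.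
by apply/eqP; rewrite -subr_eq0 -/a -sqrf_eq0 eq_le a0 sqr_ge0.
Unshelve. all: end_near.
Qed.

End pos_def.

Section pos_def_theory.
Context {R : realType} {E : hilbertType R}.
Implicit Types (Q : E -> E) (x y v w : E).

Lemma inv_opK Q : pos_def Q -> cancel (inv_op Q) Q.
Proof.
move=> Qpd; have [_ Qs [c c0 Qc]] := Qpd.
move=> b; have Qb : [set Q x | x in setT] b.
  have [//|||x xP] := @coercive_riesz _ _ Q c (dotp b) `|b| Qs c0 Qc.
  - by move=> x y; rewrite dotpDr.
  - by move=> a x; rewrite dotpZr.
  - exact: cauchy_schwarz.
  - by exists x => //; apply: dotp_inj => v; rewrite xP.
by rewrite /inv_op pinvK // inE.
Qed.

(** Coercivity of the inverse is where boundedness of Q enters: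
    |x| = |Q (Q^-1 x)| <= M |Q^-1 x|. *)
Lemma pos_def_inv_op Q : pos_def Q -> pos_def (inv_op Q).
Proof.
move=> Qpd; have [QM Qs [c c0 Qc]] := Qpd; have QK := inv_opK Qpd.
have lb x : c * `|inv_op Q x| ^+ 2 <= dotp x (inv_op Q x).
  by rewrite -{2}(QK x) Qs; exact: Qc.
split.
- exists c^-1 => x; have [->|i0] := eqVneq (inv_op Q x) 0.
    by rewrite normr0 mulr_ge0 // invr_ge0 ltW.
  rewrite ler_pdivlMl // -(ler_pM2r (x := `|inv_op Q x|)) ?normr_gt0 //.
  rewrite -mulrA -expr2; apply: le_trans (lb x) _; apply: le_trans (ler_norm _) _.
  exact: cauchy_schwarz.
- by move=> x y; rewrite -{1}(QK y) -Qs QK.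
- have [M M0 Qle] := bounded_op_gt0 QM.
  exists (c / M ^+ 2) => [|x]; first by rewrite divr_gt0 // exprn_gt0.
  apply: le_trans (lb x); rewrite -mulrA ler_pM2l // ler_pdivrMl ?exprn_gt0 //.
  by rewrite -exprMn ler_pXn2r ?nnegrE ?mulr_ge0 ?(ltW M0) // -{1}(QK x).
Qed.

Lemma pos_def_ge0 Q x : pos_def Q -> 0 <= dotp x (Q x).
Proof.
by move=> [_ _ [c c0 Qc]]; apply: le_trans (Qc x); rewrite mulr_ge0 ?sqr_ge0 // ltW.
Qed.

End pos_def_theory.

Section adjoint_theory.
Context {R : realType} {E F : hilbertType R}.

(** The value chosen by [adjoint] is the Riesz representative of the bounded
    functional x |-> <A x, s>. *)
Lemma adjointE (A : {linear E -> F}) : bounded_op A ->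
  forall x s, dotp (A x) s = dotp x (adjoint A s).
Proof.
move=> /bounded_op_gt0[M M0 AM] x s.
suff [y yP] : [set y : E | forall x : E, dotp (A x) s = dotp x y] !=set0.
  by have /= := xgetPex 0 (ex_intro _ y yP); exact.
have [|//|y|y z|a y|y|y yP] := @coercive_riesz _ E idfun 1 (fun x => dotp (A x) s) (M * `|s|).
- by [].
- by rewrite mul1r dotp_norm.
- by rewrite linearD dotpDl.
- by rewrite linearZ dotpZl.
- apply: le_trans (cauchy_schwarz _ _) _.
  by rewrite mulrAC ler_wpM2r.
- by exists y => z; rewrite yP dotpC.
Qed.

End adjoint_theory.

(** * Weak limits along ultrafilters and Opial's argument *)

Section weak_limit.
Context {R : realType} {T : Type} {F : set_system T}.
Context {UF : UltraFilter F}.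

Lemma ultra_bounded_cvg (u : T -> R) (B : R) : (forall k, `|u k| <= B) ->
  exists l : R, u k @[k --> F] --> l.
Proof.
move=> uB.
have [|l [_ cl]] := @segment_compact R (- B) B (u k @[k --> F]) _.
  by apply: nearW => k /=; rewrite in_itv /= -ler_norml.
exists l => U Ul; have [//|nU] := in_ultra_setVsetC (u @^-1` U) UF.
by have [y []] := cl (~` U) U nU Ul.
Qed.

(** Each scalar sequence <u k, w> is bounded, hence convergent along the
    ultrafilter, and its limit is a bounded linear functional of w. *)
Lemma ultra_weak_cvg {E : hilbertType R} (u : T -> E) (B : R) :
  (forall k, `|u k| <= B) ->
  exists ul, forall w, dotp (u k) w @[k --> F] --> dotp ul w.
Proof.
move=> uB.
have ub w k : `|dotp (u k) w| <= B * `|w|.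
  by rewrite (le_trans (cauchy_schwarz _ _)) // ler_wpM2r.
have [phi phiP] := choice (fun w => ultra_bounded_cvg (ub w)).
have phi_uniq w a : dotp (u k) w @[k --> F] --> a -> phi w = a.
  by move=> ua; apply: (cvg_unique (@norm_hausdorff _ _) (phiP w) ua).
have [|//|w|v w|a w|w|ul ulP] := @coercive_riesz _ E idfun 1 phi B.
- by [].
- by rewrite mul1r dotp_norm.
- apply: phi_uniq; under eq_fun do rewrite dotpDr; exact: cvgD.
- apply: phi_uniq; under eq_fun do rewrite dotpZr.
  by apply: cvgM; [exact: cvg_cst|exact: phiP].
- have := phiP w => /cvg_norm/cvgr_to_le; apply; apply: nearW => k; exact: ub.
- by exists ul => w; rewrite -ulP; exact: phiP.
Qed.

End weak_limit.

Section sequences.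
Context {R : realType}.

(** If u did not converge to l, some neighbourhood of l would be missed
    frequently, and an ultrafilter could be concentrated on those indices. *)
Lemma ultra_cvgn (u : nat -> R) (l : R) :
  (forall F : set_system nat, UltraFilter F -> \oo `<=` F -> u k @[k --> F] --> l) ->
  u k @[k --> \oo] --> l.
Proof.
move=> ul U Ul; apply: contrapT => nU.
pose G : set_system nat := fun W => \oo (u @^-1` U `|` W).
have GF : ProperFilter G.
  split; first by rewrite /G setU0.
  split => [|V W GV GW|V W VW].
  - by rewrite /G setUT; exact: filterT.
  - by rewrite /G setUIr; exact: filterI.
  - by rewrite /G; apply: filterS => k [?|/VW ?]; [left|right].
have [F [FU GF']] := ultraFilterLemma GF.
have ooF : \oo `<=` F by move=> V oV; apply: GF'; apply: filterS oV => k; right.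
have FnU : F (~` (u @^-1` U)) by apply: GF'; rewrite /G setUv; exact: filterT.
have FU' : F (u @^-1` U) := ul F FU ooF U Ul.
have FP : ProperFilter F := ultra_proper.
by apply: (@filter_not_empty _ F); rewrite -(setICr (u @^-1` U)); exact: filterI.
Qed.

Lemma sqr_norm_le_cvg0 {E : hilbertType R} {T : Type} {F : set_system T}
    {FF : Filter F} (u : T -> E) (a : T -> R) :
  (forall k, `|u k| ^+ 2 <= a k) -> a k @[k --> F] --> 0 -> u k @[k --> F] --> 0.
Proof.
move=> ua a0.
have u2 : `|u k| ^+ 2 @[k --> F] --> (0 : R).
  apply: (@squeeze_cvgr _ F _ R (cst 0) a) => //; last exact: cvg_cst.
  by apply: nearW => k; rewrite sqr_ge0 /=.
apply: norm_cvg0.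
have -> : (fun k => `|u k|) = (fun k => Num.sqrt (`|u k| ^+ 2)).
  by apply/funext => k; rewrite sqrtr_sqr normr_id.
rewrite -sqrtr0; apply: continuous_cvg => //; exact: sqrt_continuous.
Qed.

(** The increments of a convergent monotone sequence tend to 0, and they bound
    the squares of u. *)
Lemma fejer_cvg0 {E : hilbertType R} (V : nat -> R) (u : nat -> E) (c : R) :
  0 < c -> (forall k, 0 <= V k) ->
  (forall k, V k.+1 + c * `|u k| ^+ 2 <= V k) -> u k @[k --> \oo] --> 0.
Proof.
move=> c0 V0 Vdec.
have Vcvg : cvgn V.
  apply: nonincreasing_is_cvgn; last by exists 0 => _ [k _ <-].
  apply/nonincreasing_seqP => k; apply: le_trans (Vdec k).
  by rewrite lerDl mulr_ge0 ?sqr_ge0 // ltW.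
apply: (sqr_norm_le_cvg0 (a := fun k => (V k - V k.+1) / c)) => [k|].
  rewrite ler_pdivlMr // mulrC lerBrDl; exact: Vdec.
rewrite -(mul0r c^-1) -(subrr (limn V)); apply: cvgM; last exact: cvg_cst.
by apply: cvgB => //; rewrite cvg_shiftS.
Qed.

Lemma increasing_seq_cvg (phi : nat -> nat) : increasing_seq phi ->
  phi k @[k --> \oo] --> \oo.
Proof.
move=> phi_mono.
have phi_ge k : (k <= phi k)%N.
  elim: k => // k IH; apply: leq_ltn_trans IH _.
  by rewrite ltnNge; have := phi_mono k.+1 k; rewrite ltnn leEnat => ->.
by move=> U [N _ NU]; exists N => // k /= Nk; apply: NU => /=; apply: leq_trans (phi_ge k).
Qed.

End sequences.

Section opial.
Context {R : realType} {X S : hilbertType R}.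
Variables (P : X -> X) (Q : S -> S) (z : nat -> X * S) (C : set (X * S)) (b : R).

(** If (x, s) and (y, t) are weak limits along two ultrafilters, both lie in C,
    so the distances of z k to both converge; by polarisation so does
    <z k, (y, t) - (x, s)> in the metric (P, Q).  Its limit can be computed along
    either ultrafilter, and comparing the two values shows that the squared
    distance between the two weak limits is 0. *)
Lemma opial : pos_def P -> pos_def Q ->
  (forall k, `|(z k).1| <= b) -> (forall k, `|(z k).2| <= b) ->
  (forall c, C c ->
    cvgn (fun k => sqnorm P ((z k).1 - c.1) + sqnorm Q ((z k).2 - c.2))) ->
  (forall F : set_system nat, UltraFilter F -> \oo `<=` F -> forall x s,
    (forall w, dotp (z k).1 w @[k --> F] --> dotp x w) ->
    (forall w, dotp (z k).2 w @[k --> F] --> dotp s w) -> C (x, s)) ->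
  exists2 zs, C zs & weak_cvg z zs.
Proof.
move=> Ppd Qpd zb1 zb2 Vcvg Cw; have [_ Ps _] := Ppd; have [_ Qs _] := Qpd.
have [F0 [UF0 ooF0]] := ultraFilterLemma (@eventually_filter).
have [x xw] := @ultra_weak_cvg _ _ _ UF0 _ _ _ zb1.
have [s sw] := @ultra_weak_cvg _ _ _ UF0 _ _ _ zb2.
exists (x, s); first exact: Cw ooF0 _ _ xw sw.
move=> w /=; apply: ultra_cvgn => F UF ooF.
have [y yw] := @ultra_weak_cvg _ _ _ UF _ _ _ zb1.
have [t tw] := @ultra_weak_cvg _ _ _ UF _ _ _ zb2.
pose V c k := sqnorm P ((z k).1 - c.1) + sqnorm Q ((z k).2 - c.2).
pose d k := dotp (z k).1 (P (y - x)) + dotp (z k).2 (Q (t - s)).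
(* [d] is the difference of the two convergent distances, up to a constant. *)
have d_cvg : cvgn d.
  have -> : d = (fun k => 2^-1 * (V (x, s) k - V (y, t) k -
      (sqnorm P x - sqnorm P y + (sqnorm Q s - sqnorm Q t)))).
    apply/funext => k; rewrite /d /V /sqnorm /=.
    rewrite !(self_adjointB Ps) !(self_adjointB Qs) !dotpE.
    rewrite (self_adjointC (z k).1 x Ps) (self_adjointC (z k).1 y Ps).
    rewrite (self_adjointC (z k).2 s Qs) (self_adjointC (z k).2 t Qs).
    by field.
  apply: is_cvgM; first exact: is_cvg_cst.
  apply: is_cvgB; last exact: is_cvg_cst.
  by apply: is_cvgB; apply: Vcvg; [exact: Cw ooF0 _ _ xw sw|exact: Cw ooF _ _ yw tw].
have lim1 : dotp x (P (y - x)) + dotp s (Q (t - s)) = limn d.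
  apply: (cvg_unique (@norm_hausdorff _ _) (F := d k @[k --> F0])).
    by apply: cvgD.
  by apply: cvg_trans d_cvg; move=> U; exact: ooF0.
have lim2 : dotp y (P (y - x)) + dotp t (Q (t - s)) = limn d.
  apply: (cvg_unique (@norm_hausdorff _ _) (F := d k @[k --> F])).
    by apply: cvgD.
  by apply: cvg_trans d_cvg; move=> U; exact: ooF.
have [[_ _ [p p0 Pp]] [_ _ [q q0 Qq]]] := (Ppd, Qpd).
have := Pp (y - x); have := Qq (t - s).
rewrite [dotp (t - s) _]dotpBl [dotp (y - x) _]dotpBl => h1 h2.
have : p * `|y - x| ^+ 2 + q * `|t - s| ^+ 2 <= 0.
  move: lim1; rewrite -lim2; lra.
have px : 0 <= p * `|y - x| ^+ 2 by rewrite mulr_ge0 ?sqr_ge0 ?ltW.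
have qs : 0 <= q * `|t - s| ^+ 2 by rewrite mulr_ge0 ?sqr_ge0 ?ltW.
move=> sum0.
have yx : y = x.
  apply/eqP; rewrite -subr_eq0 -normr_eq0 -sqrf_eq0 eq_le sqr_ge0 andbT.
  rewrite -(pmulr_rle0 _ p0); lra.
have ts : t = s.
  apply/eqP; rewrite -subr_eq0 -normr_eq0 -sqrf_eq0 eq_le sqr_ge0 andbT.
  rewrite -(pmulr_rle0 _ q0); lra.
by rewrite -yx -ts; apply: cvgD.
Qed.

End opial.

(** * Gradients and conjugates of convex functions *)

Section gradient.
Context {R : realType} {E : hilbertType R}.
Implicit Types (g : E -> \bar R) (x y v : E).

(** The differential is a continuous linear functional, so the Riesz
    representative chosen by [grad] exists. *)
Lemma gradE g x v : differentiable (fine \o g) x ->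
  'd (fine \o g) x v = dotp (grad g x) v.
Proof.
move=> gx.
suff [w wP] : [set w : E | forall v, 'd (fine \o g) x v = dotp w v] !=set0.
  by have /= := xgetPex 0 (ex_intro _ w wP); exact.
have /linear_boundedP/pinfty_ex_gt0[M M0 dM] :=
  (linear_bounded_continuous ('d (fine \o g) x)).2 (diff_continuous gx).
have [|//|y|y z|a y|y|w wP] := @coercive_riesz _ E idfun 1 ('d (fine \o g) x : E -> R) M.
- by [].
- by rewrite mul1r dotp_norm.
- by rewrite linearD.
- by rewrite linearZ.
- exact: dM.
- by exists w.
Qed.

(** Convexity bounds the difference quotients in the direction x - y by
    g x - g y; let the step tend to 0 from the right. *)
Lemma grad_ineq g x y : econvex g -> frechet_differentiable g ->
  fine (g y) + dotp (grad g y) (x - y) <= fine (g x).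
Proof.
move=> gc [gf gd]; have gy := gd y.
rewrite addrC -lerBrDr -gradE // -deriveE //.
have Dlim : h^-1 *: (((fine \o g) \o shift y) (h *: (x - y)) - (fine \o g) y)
    @[h --> 0^'] --> 'D_(x - y) (fine \o g) y.
  exact: diff_derivable.
move/cvg_dnbhs_at_right : Dlim => Dlim.
apply: (cvgr_to_le Dlim); near=> t.
have t0 : 0 < t by near: t; exact: nbhs_right_gt.
have t1 : t < 1 by near: t; exact: nbhs_right_lt.
rewrite /= /GRing.scale /= ler_pdivrMl //.
have := gc x y t; rewrite t0 t1 => /(_ isT).
have -> : t *: x + (1 - t) *: y = t *: (x - y) + y.
  by rewrite scalerBl scale1r scalerBr addrA addrAC.
rewrite -(fineK (gf x)) -(fineK (gf y)) -(fineK (gf (t *: (x - y) + y))).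
rewrite -!EFinM -EFinD lee_fin /=; lra.
Unshelve. all: end_near.
Qed.

Lemma grad_monotone g x y : econvex g -> frechet_differentiable g ->
  0 <= dotp (x - y) (grad g x - grad g y).
Proof.
move=> gc gd; have := grad_ineq x y gc gd; have := grad_ineq y x gc gd.
rewrite -(opprB x y) dotpNr (dotpC (x - y)) dotpBl.
move: (dotp (grad g x) _) (dotp (grad g y) _) => p q; lra.
Qed.

End gradient.

Section conjugate_theory.
Context {R : realType} {E : hilbertType R}.
Implicit Types (g : E -> \bar R) (x y v u : E).

Lemma conjugate_ge g y u : ((dotp y u)%:E - g y <= conjugate g u)%E.
Proof. by apply: ereal_sup_ubound; exists y. Qed.

Lemma conjugate_gtNy g u : Defs.proper g -> (-oo < conjugate g u)%E.
Proof.
move=> [gN [y gy]]; apply: lt_le_trans (conjugate_ge g y u).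
by case: (g y) (gN y) gy => // r _ _; exact: ltNyr.
Qed.

Lemma econvex_conjugate g : Defs.proper g -> econvex (conjugate g).
Proof.
move=> [gN _] u v t /andP[t0 t1]; apply: ge_ereal_sup => _ [y _ <-].
have := conjugate_ge g y u; have := conjugate_ge g y v.
case: (g y) (gN y) => [r| |] // _; last by move=> _ _; rewrite /= leNye.
move=> hv hu.
have -> : ((dotp y (t *: u + (1 - t) *: v))%:E - r%:E =
  t%:E * ((dotp y u)%:E - r%:E) + (1 - t)%:E * ((dotp y v)%:E - r%:E))%E.
  by rewrite -!EFinB -!EFinM -EFinD !dotpE; congr EFin; ring.
by apply: leeD; apply: lee_wpmul2l; rewrite // lee_fin ?ltW // subr_gt0.
Qed.

(** The graph of the subdifferential of a conjugate is closed for weak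
    convergence of both components, provided their product passes to the limit.
    The conjugate is a supremum of weakly continuous affine functions, and each
    of these can be tested separately in the subgradient inequality. *)
Lemma subdiff_conjugate_closed {T : Type} {F : set_system T} {FF : ProperFilter F}
    g (s q : T -> E) (sl ql : E) : Defs.proper g ->
  (forall k, subdiff (conjugate g) (s k) (q k)) ->
  (forall w, dotp (s k) w @[k --> F] --> dotp sl w) ->
  (forall w, dotp (q k) w @[k --> F] --> dotp ql w) ->
  dotp (s k) (q k) @[k --> F] --> dotp sl ql ->
  subdiff (conjugate g) sl ql.
Proof.
move=> gp sq ssl qql sqsl.
(* This gives the subgradient inequality at [v], and also finiteness at [sl]. *)
have key v c : conjugate g v = c%:E ->
    (conjugate g sl <= (c - dotp (v - sl) ql)%:E)%E.
  move=> gv; apply: ge_ereal_sup => _ [y _ <-].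
  have gy := fun k => conjugate_ge g y (s k).
  case: (g y) (gp.1 y) gy => [r| |] // _ gy; last by rewrite /= leNye.
  rewrite -EFinB lee_fin.
  have lim : dotp (s k) y - r + (dotp (q k) v - dotp (s k) (q k)) @[k --> F]
      --> dotp sl y - r + (dotp ql v - dotp sl ql).
    by apply: cvgD; apply: cvgB => //; exact: cvg_cst.
  suff : dotp sl y - r + (dotp ql v - dotp sl ql) <= c.
    rewrite dotpBl (dotpC sl y) (dotpC ql v); lra.
  apply: (cvgr_to_le lim); apply: nearW => k.
  have [fk /(_ v)] := sq k; have := gy k.
  rewrite gv -(fineK fk) -EFinB -EFinD !lee_fin dotpBl (dotpC y) (dotpC v); lra.
have [k _] := filter_ex (@filterT _ F _).
have gsl : conjugate g sl \is a fin_num.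
  have [fk _] := sq k; have := key (s k) _ (esym (fineK fk)).
  have := conjugate_gtNy sl gp.
  by case: (conjugate g sl).
split => // v; have := key v; have := conjugate_gtNy v gp.
case: (conjugate g v) => [c| |] // _; last by rewrite leey.
move=> /(_ _ erefl); rewrite -(fineK gsl) -EFinD !lee_fin; lra.
Qed.

End conjugate_theory.

Section demiclosed.
Context {R : realType} {E : hilbertType R} {T : Type} {F : set_system T}.
Context {FF : ProperFilter F}.

(** Minty's trick: the limit of the monotonicity inequalities reads
    0 <= <ul - v, gl - G v> for every v; take v = ul + t (gl - G ul) with t > 0
    and let t tend to 0, using the Lipschitz bound on G. *)
Lemma monotone_demiclosed (G : E -> E) (u : T -> E) (B : R) (ul gl : E) :
  (forall x y, 0 <= dotp (x - y) (G x - G y)) -> lipschitz G ->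
  (forall k, `|u k| <= B) ->
  (forall w, dotp (u k) w @[k --> F] --> dotp ul w) ->
  G (u k) @[k --> F] --> gl ->
  G ul = gl.
Proof.
move=> Gm GL uB uul Ggl.
have mono v : 0 <= dotp (ul - v) (gl - G v).
  have lim : dotp (u k) (G (u k) - G v) - dotp (G (u k) - G v) v @[k --> F]
      --> dotp ul (gl - G v) - dotp (gl - G v) v.
    have Gv : G (u k) - G v @[k --> F] --> gl - G v.
      by apply: cvgB => //; exact: cvg_cst.
    by apply: cvgB; [exact: cvg_dotp_weak_strong Gv|exact: cvg_dotpl].
  rewrite (dotpBl ul) (dotpC v); apply: (cvgr_to_ge lim); apply: nearW => k.
  by have := Gm (u k) v; rewrite (dotpBl (u k)) (dotpC v).
have /pinfty_ex_gt0[L L0 GL'] := GL.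
have Gl x y : `|G x - G y| <= L * `|x - y| by exact: (GL' (x, y)).
pose d := gl - G ul.
have small t : 0 < t -> `|d| ^+ 2 <= L * `|d| ^+ 2 * t.
  move=> t0; have := mono (ul + t *: d).
  rewrite opprD addNKr dotpNl dotpZl oppr_ge0 pmulr_rle0 //.
  have -> : gl - G (ul + t *: d) = d - (G (ul + t *: d) - G ul).
    by rewrite /d opprB addrA subrK.
  rewrite dotpBr dotp_norm subr_le0 => /le_trans; apply.
  apply: le_trans (ler_norm _) _; apply: le_trans (cauchy_schwarz _ _) _.
  apply: le_trans (ler_wpM2l (normr_ge0 _) (Gl _ _)) _.
  by rewrite [ul + _]addrC addrK normrZ gtr0_norm // expr2; lra.
apply/eqP; rewrite eq_sym -subr_eq0 -/d -normr_eq0 -sqrf_eq0 eq_le sqr_ge0 andbT.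
(* With this t the bound [small] reads |d|^2 <= |d|^2 / 2. *)
have t0 : 0 < (2 * L)^-1 by rewrite invr_gt0 mulr_gt0.
have := small _ t0.
have -> : L * `|d| ^+ 2 * (2 * L)^-1 = `|d| ^+ 2 / 2 by field; rewrite gt_eqF.
lra.
Qed.

End demiclosed.

(** * The energy of one step *)

Section step.
Context {R : realType} {X S : hilbertType R}.
Variables (A : {linear X -> S}) (P : {linear X -> X}) (D : {linear S -> S}).
Variables (tau sigma theta : R).
Hypotheses (Abd : bounded_op A) (Ppd : pos_def P).
Hypotheses (tau0 : 0 < tau) (sigma0 : 0 < sigma).

Local Notation G := (inv_op P).
Local Notation B := (adjoint A).
Local Notation M := (opM A P D tau sigma).
Local Notation M1 := (opM A P D tau sigma theta).

Hypothesis M1pd : pos_def M1.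

Let Gs : self_adjoint G. Proof. by case: (pos_def_inv_op Ppd). Qed.

Lemma adjointB : {morph B : x y / x - y}.
Proof.
move=> x y; apply: dotp_inj => v.
by rewrite dotpBl !(dotpC _ v) -!adjointE // dotpBr.
Qed.

Lemma opM_shift th s :
  opM A P D tau sigma th s = M1 s + ((theta - th) * tau ^+ 2) *: A (G (B s)).
Proof.
by apply: dotp_inj => v; rewrite /opM !dotpE; field; rewrite gt_eqF.
Qed.

Lemma opMB th : {morph opM A P D tau sigma th : s s' / s - s'}.
Proof.
move=> s s'; apply: dotp_inj => v.
rewrite /opM (linearB D) adjointB (self_adjointB Gs) (linearB A) !dotpE; ring.
Qed.

Lemma dotp_AGB s s' : dotp (A (G (B s))) s' = dotp (B s) (G (B s')).
Proof. by rewrite adjointE // Gs. Qed.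

Lemma adjoint_bounded : exists2 c, 0 < c & forall s, `|B s| <= c * `|s|.
Proof.
have [c c0 Ac] := bounded_op_gt0 Abd; exists c => // s.
have [->|Bs0] := eqVneq (B s) 0; first by rewrite normr0 mulr_ge0 // ltW.
rewrite -(ler_pM2l (x := `|B s|)) ?normr_gt0 // -expr2 -dotp_norm -adjointE //.
apply: le_trans (ler_norm _) _; apply: le_trans (cauchy_schwarz _ _) _.
by rewrite mulrA ler_wpM2r // mulrC.
Qed.

Lemma opM_bounded th : bounded_op (opM A P D tau sigma th).
Proof.
have [Mb _ _] := M1pd; have [Gb _ _] := pos_def_inv_op Ppd.
have [a a0 aP] := bounded_op_gt0 Mb; have [a' a'0 a'P] := bounded_op_gt0 Abd.
have [b b0 bP] := adjoint_bounded; have [d d0 dP] := bounded_op_gt0 Gb.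
exists (a + `|(theta - th) * tau ^+ 2| * (a' * (d * b))) => s.
rewrite (opM_shift th) [leRHS]mulrDl; apply: le_trans (ler_normD _ _) _; apply: lerD => //.
rewrite normrZ -(mulrA `|_|) ler_wpM2l // -mulrA.
apply: le_trans (a'P _) _; rewrite ler_wpM2l ?(ltW a'0) // -mulrA.
by apply: le_trans (dP _) _; rewrite ler_wpM2l ?(ltW d0).
Qed.

(** Decreasing the parameter adds a nonnegative multiple of A G B.  The values
    of interest are 1/2, the dual metric of the energy, and 0, which gives a
    multiple of D. *)
Lemma pos_def_opM th : th <= theta -> pos_def (opM A P D tau sigma th).
Proof.
move=> th_le; have [_ Ms [c c0 Mc]] := M1pd.
have k0 : 0 <= (theta - th) * tau ^+ 2.
  by rewrite mulr_ge0 ?sqr_ge0 // subr_ge0.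
split.
- exact: opM_bounded.
- move=> s s'; rewrite !(opM_shift th) dotpDl dotpDr dotpZl dotpZr Ms dotp_AGB.
  by rewrite (dotpC s (A _)) dotp_AGB (self_adjointC _ _ Gs).
- exists c => // s; rewrite (opM_shift th) dotpDr dotpZr (dotpC s (A _)) dotp_AGB.
  apply: le_trans (Mc s) _; rewrite lerDl mulr_ge0 // pos_def_ge0 //.
  exact: pos_def_inv_op.
Qed.

(** With [opM_shift], the second term is
    <s, M(theta) s> + (theta - 1/2) tau^2 <B s, G (B s)>, where M(theta) is
    [opM] at theta.  The weight theta - 1/2 is
    the c that maximises c (1 - c - 2 (1 - theta)), the product of the two
    diagonal coefficients of the quadratic form in B r and B r' left over by one
    step, whose off-diagonal coefficient 1 - theta does not depend on c. *)
Definition energy (x : X) (s : S) : R :=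
  sqnorm P x + sqnorm (opM A P D tau sigma 2^-1) s.

(** The vectors e, r, g, dw stand for the differences x - x0, s - s0 and those
    of the two gradients; primes refer to the next iterate.  Young's inequality
    with weight alpha < 1 lets the dual gradient term be evaluated at r instead of
    r' and still leaves a multiple of |r - r'|^2.  The cross term in B r and B r'
    is absorbed by completing the square |B r + B r'|^2, weighted by 1 - theta. *)
Lemma energy_decrease (beta alpha rho : R) (e e' g : X) (r r' dw : S) :
  theta <= 1 -> 3 / 4 <= theta -> 0 < alpha -> alpha * rho = tau ->
  e' = e - tau *: G (g + B r') ->
  0 <= dotp r' (A e' - dw + tau^-1 *: M 1 (r - r')) ->
  beta * sqnorm G g <= dotp e g ->
  beta * sqnorm (inv_op M1) dw <= dotp r dw ->
  energy e' r' + (tau * (2 * beta - tau) * sqnorm G g +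
    (2 * theta - 3 / 2) * tau ^+ 2 * sqnorm G (B r) +
    (1 - alpha) * sqnorm M1 (r - r') +
    tau * (2 * beta - rho) * sqnorm (inv_op M1) dw) <= energy e r.
Proof.
move=> th1 th34 al0 alrho e'E dq_ge0 eg_ge rw_ge.
have [_ Ps _] := Ppd; have [_ Ms _] := M1pd.
have AE := adjointE Abd.
have GP v x : dotp (G v) (P x) = dotp v x by rewrite -Ps inv_opK.
have GB := dotp_AGB; have MK := inv_opK M1pd.
have ME := opM_shift; have Mge0 x := pos_def_ge0 x M1pd.
rewrite /energy /sqnorm !(ME 2^-1); move: dq_ge0; rewrite (ME 1) => dq_ge0.
(* [M1] is replaced by a variable, so that expanding inner products does not
   unfold it. *)
move: M1 Ms ME MK Mge0 rw_ge dq_ge0 => m Ms ME MK Mge0 rw_ge dq_ge0.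
(* The monotonicity inequality multiplied by tau, expanded. *)
have opt : dotp r' (m r') + theta * tau ^+ 2 * dotp (B r') (G (B r')) <=
   dotp r (m r') - (1 - theta) * tau ^+ 2 * dotp (B r) (G (B r')) +
   tau * dotp e (B r') - tau ^+ 2 * dotp g (G (B r')) - tau * dotp r' dw.
  have := mulr_ge0 (ltW tau0) dq_ge0.
  rewrite adjointB !(self_adjointB Gs) e'E (dotpC r') (self_adjointB Ms).
  rewrite !linearB linearZ (self_adjointD Gs) !linearD /= !(dotpE, GB, AE, Ms, Gs).
  rewrite (dotpC dw).
  by rewrite !(mulrDr tau) !mulrA divff ?gt_eqF // !mul1r; lra.
have e'P : sqnorm P e' = sqnorm P e - 2 * tau * dotp e g - 2 * tau * dotp e (B r') +
    tau ^+ 2 * (sqnorm G g + 2 * dotp g (G (B r')) + sqnorm G (B r')).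
  have Pe' : P e' = P e - tau *: g - tau *: B r'.
    rewrite e'E linearB linearZ (self_adjointD Gs) linearD /= !inv_opK //.
    by rewrite scalerDr opprD addrA.
  rewrite /sqnorm Pe' e'E (self_adjointD Gs) !dotpE !(GP, Gs) (dotpC g e) (dotpC (B r') e).
  rewrite (self_adjointC _ _ Gs); ring.
have young : 2 * tau * dotp (r - r') dw <=
    alpha * sqnorm m (r - r') + tau * rho * sqnorm (inv_op m) dw.
  have := mulr_ge0 (ltW al0) (Mge0 ((r - r') - rho *: inv_op m dw)).
  move: (r - r') => d; rewrite (self_adjointB Ms) (self_adjointZ _ Ms) MK !dotpE.
  rewrite -(Ms (inv_op m dw)) MK /sqnorm (dotpC (inv_op m dw)) (dotpC dw d) -alrho; lra.
have cross : 0 <= (1 - theta) * tau ^+ 2 *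
    (sqnorm G (B r) + 2 * dotp (B r) (G (B r')) + sqnorm G (B r')).
  rewrite !mulr_ge0 ?(ltW tau0) ?subr_ge0 //.
  have := pos_def_ge0 (B r + B r') (pos_def_inv_op Ppd).
  rewrite (self_adjointD Gs) !dotpE (self_adjointC (B r) (B r') Gs) /sqnorm; lra.
have rest : 0 <= (2 * theta - 3 / 2) * tau ^+ 2 * sqnorm G (B r').
  rewrite !mulr_ge0 ?(ltW tau0) ?pos_def_ge0 //; [lra|exact: pos_def_inv_op].
have := ler_wpM2l (ltW tau0) eg_ge; have := ler_wpM2l (ltW tau0) rw_ge.
move: young opt e'P; rewrite /sqnorm => young opt ->; move: young opt.
rewrite (self_adjointB Ms) !dotpE !(dotpC _ (A _)) !GB.
rewrite (self_adjointC r r' Ms).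
move: cross rest; rewrite /sqnorm.
lra.
Qed.

End step.

(** * The iteration as an optimality system *)

Section iteration_theory.
Context {R : realType} {X S : hilbertType R}.
Variables (f : X -> \bar R) (h l : S -> \bar R).
Variables (A : {linear X -> S}) (P : {linear X -> X}) (D : {linear S -> S}).
Variables (tau sigma theta : R).
Hypotheses (Abd : bounded_op A) (Ppd : pos_def P).
Hypotheses (tau0 : 0 < tau) (sigma0 : 0 < sigma) (theta_ge0 : 0 <= theta).
Hypothesis M1pd : pos_def (opM A P D tau sigma theta).

Local Notation G := (inv_op P).
Local Notation B := (adjoint A).
Local Notation M := (opM A P D tau sigma 1).
Local Notation gl := (grad (conjugate l)).
Local Notation step := (iterI f h l A P D tau sigma).

Lemma subdiff_monotone {E : hilbertType R} (g : E -> \bar R) x y p q :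
  subdiff g x p -> subdiff g y q -> 0 <= dotp (x - y) (p - q).
Proof.
move=> [gx /(_ y) hx] [gy /(_ x) hy].
move: hx hy; rewrite -(fineK gx) -(fineK gy) -!EFinD !lee_fin.
rewrite !dotpE; lra.
Qed.

(** Both the resolvent equation and the update of x are used: A applied to the
    update replaces the gradient step inside the resolvent by A z'.1, at the cost
    of tau A G B z'.2, and tau sigma A G B is exactly D - (sigma / tau) M. *)
Lemma stepE (z z' : X * S) : step z z' <->
  subdiff (conjugate h) z'.2 (A z'.1 - gl z.2 + tau^-1 *: (M z.2 - M z'.2)) /\
  z'.1 = z.1 - tau *: G (grad f z.1 + B z'.2).
Proof.
have [_ Gs _] := pos_def_inv_op Ppd.
case: z z' => x s [x' s'] /=.
have xE : (x' = x - tau *: G (grad f x) - tau *: G (B s')) <->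
          (x' = x - tau *: G (grad f x + B s')).
  by rewrite (self_adjointD Gs) scalerDr opprD addrA.
rewrite -xE.
suff key : x' = x - tau *: G (grad f x) - tau *: G (B s') ->
    (sigma / tau) *: M s + sigma *: A (x - tau *: G (grad f x)) - sigma *: gl s =
    D s' + sigma *: (A x' - gl s + tau^-1 *: (M s - M s')).
  split => [[[q qs uE] x'E]|[qs x'E]]; split => //.
    suff -> : A x' - gl s + tau^-1 *: (M s - M s') = q by [].
    apply: (@scalerI _ _ sigma); first by rewrite gt_eqF.
    by apply: (addrI (D s')); rewrite -key // uE.
  by exists (A x' - gl s + tau^-1 *: (M s - M s')) => //; exact: key.
move=> x'E; apply: dotp_inj => v.
have -> : A (x - tau *: G (grad f x)) = A x' + tau *: A (G (B s')).
  by rewrite x'E [RHS]addrC !(linearB A) [A (tau *: G (B s'))]linearZ /= addrC subrK.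
have -> : M s' = (tau / sigma) *: (D s' - (tau * sigma) *: A (G (B s'))).
  by rewrite /opM mul1r.
move: (M s) => Ms; rewrite !dotpE; field; rewrite !gt_eqF //.
Qed.

Lemma fixed_stepE (z : X * S) : iterI_fixed f h l A P D tau sigma z <->
  subdiff (conjugate h) z.2 (A z.1 - gl z.2) /\ grad f z.1 = - B z.2.
Proof.
have [_ Gs _] := pos_def_inv_op Ppd.
rewrite /iterI_fixed stepE subrr scaler0 addr0.
split => -[hz zE]; split => //.
  apply/eqP; rewrite -subr_eq0 opprK -(inv_opK Ppd (_ + _)).
  have -> : G (grad f z.1 + B z.2) = 0.
    apply: (@scalerI _ _ tau); first by rewrite gt_eqF.
    by apply/eqP; rewrite scaler0 -oppr_eq0 -(inj_eq (addrI z.1)) addr0 -zE.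
  by rewrite linear0.
by rewrite zE addNr -[0](scale0r 0) (self_adjointZ _ Gs) !scale0r scaler0 subr0.
Qed.

(** D is positive definite, being a multiple of [opM] at parameter 0, so the
    resolvent has at most one value by monotonicity of the subdifferential. *)
Lemma step_uniq z z1 z2 : step z z1 -> step z z2 -> z1 = z2.
Proof.
case: z z1 z2 => x s [x1 s1] [x2 s2] /= [[q1 hq1 u1] ->] [[q2 hq2 u2] ->].
suff -> : s1 = s2 by [].
have M0pd := pos_def_opM Abd Ppd sigma0 M1pd theta_ge0.
have DE v : D v = (sigma / tau) *: opM A P D tau sigma 0 v.
  by apply: dotp_inj => w; rewrite /opM !dotpE; field; rewrite !gt_eqF.
have [_ _ [c c0 M0c]] := M0pd.
have Dd : D (s1 - s2) = - (sigma *: (q1 - q2)).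
  by apply/eqP; rewrite linearB -addr_eq0 scalerBr addrACA -opprD -u1 -u2 subrr.
apply/eqP; rewrite -subr_eq0 -normr_eq0 -sqrf_eq0 eq_le sqr_ge0 andbT.
rewrite -(pmulr_rle0 _ c0); apply: le_trans (M0c _) _.
have st0 : 0 < sigma / tau by rewrite divr_gt0.
rewrite -(pmulr_rle0 _ st0) -dotpZr -DE Dd dotpNr dotpZr oppr_le0.
by rewrite mulr_ge0 ?(ltW sigma0) //; exact: subdiff_monotone hq1 hq2.
Qed.

End iteration_theory.

(** * Fejer monotonicity and weak limit points *)

Section convergence.
Context {R : realType} {X S : hilbertType R}.
Variables (f : X -> \bar R) (h l : S -> \bar R).
Variables (A : {linear X -> S}) (P : {linear X -> X}) (D : {linear S -> S}).
Variables (tau sigma theta beta : R).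
Hypotheses (Abd : bounded_op A) (Ppd : pos_def P).
Hypotheses (tau0 : 0 < tau) (sigma0 : 0 < sigma).
Hypotheses (theta34 : 3 / 4 < theta) (theta1 : theta <= 1).
Hypothesis M1pd : pos_def (opM A P D tau sigma theta).
Hypotheses (fconv : econvex f) (fsmooth : smooth f).
Hypotheses (hproper : Defs.proper h).
Hypotheses (lproper : Defs.proper l) (lsmooth : smooth (conjugate l)).
Hypotheses (beta0 : 0 < beta) (tau2 : tau < 2 * beta).

Local Notation G := (inv_op P).
Local Notation B := (adjoint A).
Local Notation M := (opM A P D tau sigma 1).
Local Notation M1 := (opM A P D tau sigma theta).
Local Notation gl := (grad (conjugate l)).
Local Notation step := (iterI f h l A P D tau sigma).
Local Notation fixed := (iterI_fixed f h l A P D tau sigma).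
Local Notation dist c z := (energy A P D tau sigma (z.1 - c.1) (z.2 - c.2)).

(** The pairs u k and u' k are consecutive iterates, and c is any fixed point:
    the strong limits of the gradients and of B s_k identify grad f x, grad l* s
    and B s with their values at c.  In the subgradient inequality,
    <s_k, A x_k> = <B s_k, x_k> is a product of a strongly and a weakly convergent
    sequence. *)
Lemma weak_limit_fixed {T : Type} {F : set_system T} {FF : ProperFilter F}
    (u u' : T -> X * S) (b : R) (x : X) (s : S) (c : X * S) :
  (forall k, step (u k) (u' k)) ->
  (forall k, `|(u k).1| <= b) -> (forall k, `|(u k).2| <= b) ->
  (forall k, `|(u' k).1| <= b) -> (forall k, `|(u' k).2| <= b) ->
  (u k).1 - (u' k).1 @[k --> F] --> 0 -> (u k).2 - (u' k).2 @[k --> F] --> 0 ->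
  grad f (u k).1 @[k --> F] --> grad f c.1 ->
  gl (u k).2 @[k --> F] --> gl c.2 ->
  B (u' k).2 @[k --> F] --> B c.2 ->
  (forall v, dotp (u k).1 v @[k --> F] --> dotp x v) ->
  (forall v, dotp (u k).2 v @[k --> F] --> dotp s v) ->
  fixed c -> fixed (x, s).
Proof.
move=> ustep b1 b2 b1' b2' d1 d2 gf gls Bs x1 s2 /(fixed_stepE f h l A D Ppd tau0 sigma0)[_ gfc].
have x1' : forall v, dotp (u' k).1 v @[k --> F] --> dotp x v.
  exact: weak_cvg_shift x1 d1.
have s2' : forall v, dotp (u' k).2 v @[k --> F] --> dotp s v.
  exact: weak_cvg_shift s2 d2.
have gx : grad f x = grad f c.1.
  apply: monotone_demiclosed b1 x1 gf; last exact: fsmooth.2.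
  by move=> y y'; apply: grad_monotone => //; exact: fsmooth.1.
have gs2 : gl s = gl c.2.
  apply: monotone_demiclosed b2 s2 gls; last exact: lsmooth.2.
  move=> y y'; apply: grad_monotone; last exact: lsmooth.1.
  exact: econvex_conjugate.
have Bsc : B s = B c.2.
  apply: dotp_inj => v; apply: (cvg_unique (@norm_hausdorff _ _)
    (F := dotp (B (u' k).2) v @[k --> F])); last exact: cvg_dotpl.
  have -> : (fun k => dotp (B (u' k).2) v) = (fun k => dotp (u' k).2 (A v)).
    by apply/funext => k; rewrite dotpC -(adjointE Abd) dotpC.
  by rewrite /= dotpC -(adjointE Abd) dotpC; exact: s2'.
apply/(fixed_stepE f h l A D Ppd tau0 sigma0); split; last by rewrite gx gfc Bsc.
have uE k := (stepE f h l A D Ppd tau0 sigma0 (u k) (u' k)).1 (ustep k).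
have Md : tau^-1 *: (M (u k).2 - M (u' k).2) @[k --> F] --> 0.
  rewrite -(scaler0 _ tau^-1); apply: cvgZr.
  have -> : (fun k => M (u k).2 - M (u' k).2) = (fun k => M ((u k).2 - (u' k).2)).
    by apply/funext => k; rewrite opMB.
  by apply: bounded_op_cvg0 d2; exact: opM_bounded M1pd _.
apply: (@subdiff_conjugate_closed _ _ _ F _ h (fun k => (u' k).2)
  (fun k => A (u' k).1 - gl (u k).2 + tau^-1 *: (M (u k).2 - M (u' k).2)) s (A x - gl s) hproper).
- by move=> k; have [] := uE k.
- exact: s2'.
- move=> v; rewrite -[X in _ --> X]addr0 -(dotp0l v) dotpBl (adjointE Abd) gs2.
  under eq_fun do rewrite /= dotpDl dotpBl (adjointE Abd).
  by apply: cvgD; [apply: cvgB; [exact: x1'|exact: cvg_dotpl]|exact: cvg_dotpl].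
- rewrite -[X in _ --> X]addr0 dotpBr (dotpC s (A x)) (adjointE Abd) gs2 Bsc.
  under eq_fun do rewrite /= dotpDr dotpBr (dotpC _ (A _)) (adjointE Abd).
  apply: cvgD; last exact: cvg_dotp_bounded0 b2' Md.
  by apply: cvgB; [exact: cvg_dotp_weak_strong b1' x1' Bs|exact: cvg_dotp_weak_strong b2' s2' gls].
Qed.

Hypothesis coco : forall (xs : X) (ss : S), fixed (xs, ss) ->
   forall (x : X) (s : S),
     beta * sqnorm (inv_op P) (grad f x - grad f xs)
       <= dotp (x - xs) (grad f x - grad f xs) /\
     beta * sqnorm (inv_op M1)
              (grad (conjugate l) s - grad (conjugate l) ss)
       <= dotp (s - ss) (grad (conjugate l) s - grad (conjugate l) ss).

(** Specialises [energy_decrease] to alpha = (2 beta + tau) / (4 beta), the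
    midpoint of tau / (2 beta) and 1: this keeps both 1 - alpha and
    2 beta - tau / alpha positive. *)
Lemma fejer_step : exists2 kappa : R, 0 < kappa & forall c z z', fixed c -> step z z' ->
  dist c z' + kappa * (`|grad f z.1 - grad f c.1| ^+ 2 + `|B (z.2 - c.2)| ^+ 2 +
    `|z.2 - z'.2| ^+ 2 + `|gl z.2 - gl c.2| ^+ 2) <= dist c z.
Proof.
have [_ _ [a a0 aP]] := pos_def_inv_op Ppd.
have [_ _ [b b0 bP]] := M1pd.
have [_ _ [d d0 dP]] := pos_def_inv_op M1pd.
pose alpha := (2 * beta + tau) / (4 * beta); pose rho := 4 * beta * tau / (2 * beta + tau).
have bt0 : 0 < 2 * beta + tau by rewrite addr_gt0 // mulr_gt0.
have b2t0 : 0 < 2 * beta - tau by rewrite subr_gt0.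
have al0 : 0 < alpha by rewrite divr_gt0 // mulr_gt0.
have alrho : alpha * rho = tau by rewrite /alpha /rho; field; rewrite !gt_eqF.
have al1 : 0 < 1 - alpha.
  have -> : 1 - alpha = (2 * beta - tau) / (4 * beta) by rewrite /alpha; field; rewrite gt_eqF.
  by rewrite divr_gt0 // mulr_gt0.
have rho1 : 0 < 2 * beta - rho.
  have -> : 2 * beta - rho = 2 * beta * (2 * beta - tau) / (2 * beta + tau).
    by rewrite /rho; field; rewrite gt_eqF.
  by rewrite divr_gt0 // !mulr_gt0.
pose k1 := tau * (2 * beta - tau) * a.
pose k2 := (2 * theta - 3 / 2) * tau ^+ 2 * a.
pose k3 := (1 - alpha) * b.
pose k4 := tau * (2 * beta - rho) * d.
have k10 : 0 < k1 by rewrite !mulr_gt0.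
have th0 : 0 < 2 * theta - 3 / 2 by have := theta34; lra.
have k20 : 0 < k2 by rewrite !mulr_gt0 ?exprn_gt0.
have k30 : 0 < k3 by rewrite !mulr_gt0.
have k40 : 0 < k4 by rewrite !mulr_gt0.
pose kappa := Num.min (Num.min k1 k2) (Num.min k3 k4).
have kap1 : kappa <= k1 by rewrite /kappa !ge_min lexx.
have kap2 : kappa <= k2 by rewrite /kappa !ge_min lexx orbT.
have kap3 : kappa <= k3 by rewrite /kappa !ge_min lexx !orbT.
have kap4 : kappa <= k4 by rewrite /kappa !ge_min lexx !orbT.
exists kappa; first by rewrite !lt_min k10 k20 k30 k40.
move=> c z z' cfix zstep.
have [zq zx] := (stepE f h l A D Ppd tau0 sigma0 z z').1 zstep.
have [cq cx] := (fixed_stepE f h l A D Ppd tau0 sigma0 c).1 cfix.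
have cfix' : fixed (c.1, c.2) by rewrite -surjective_pairing.
have [coco1 coco2] := coco cfix' z.1 z.2.
have zx' : z'.1 - c.1 = (z.1 - c.1) - tau *: G (grad f z.1 - grad f c.1 + B (z'.2 - c.2)).
  by rewrite zx (adjointB Abd) cx opprK addrACA subrr addr0 addrAC.
have rr : (z.2 - c.2) - (z'.2 - c.2) = z.2 - z'.2 by rewrite opprB addrA subrK.
have q_ge0 : 0 <= dotp (z'.2 - c.2) (A (z'.1 - c.1) - (gl z.2 - gl c.2) +
    tau^-1 *: M ((z.2 - c.2) - (z'.2 - c.2))).
  rewrite rr (opMB D tau sigma Abd Ppd) linearB.
  have := subdiff_monotone zq cq.
  by rewrite addrAC [- (A c.1 - _)]opprD addrACA -opprD.
have := energy_decrease Abd Ppd tau0 sigma0 M1pd theta1 (ltW theta34) al0 alrho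
  zx' q_ge0 coco1 coco2.
apply: le_trans; rewrite lerD2l !(mulrDr kappa); apply: lerD; [apply: lerD; [apply: lerD|]|].
- apply: le_trans (ler_wpM2r (sqr_ge0 _) kap1) _; rewrite /k1 -(mulrA _ a) ler_wpM2l //.
  by rewrite mulr_ge0 ?(ltW tau0) ?(ltW b2t0).
- apply: le_trans (ler_wpM2r (sqr_ge0 _) kap2) _; rewrite /k2 -(mulrA _ a) ler_wpM2l //.
  by rewrite mulr_ge0 ?sqr_ge0 ?(ltW th0).
- apply: le_trans (ler_wpM2r (sqr_ge0 _) kap3) _; rewrite /k3 -(mulrA _ b) rr.
  by rewrite ler_wpM2l ?(ltW al1).
- apply: le_trans (ler_wpM2r (sqr_ge0 _) kap4) _; rewrite /k4 -(mulrA _ d) ler_wpM2l //.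
  by rewrite mulr_ge0 ?(ltW tau0) ?(ltW rho1).
Qed.

End convergence.

(** * Convergence of the iterates *)

Theorem theorem2 (R : realType) (X S : hilbertType R)
    (f : X -> \bar R) (h l : S -> \bar R)
    (A : {linear X -> S}) (P : {linear X -> X}) (D : {linear S -> S})
    (tau sigma theta beta : R)
    (z : nat -> X * S) :
  bounded_op A ->
  bounded_op P -> self_adjoint P ->
  bounded_op D -> self_adjoint D ->
  0 < tau -> 0 < sigma -> 3%:R / 4%:R < theta <= 1 ->
  proper_lsc_convex f -> proper_lsc_convex h -> proper_lsc_convex l ->
  smooth f -> smooth (conjugate l) ->
  pos_def P -> pos_def (opM A P D tau sigma theta) ->
  (exists zs, iterI_fixed f h l A P D tau sigma zs) ->
  0 < beta ->
  (forall (xs : X) (ss : S), iterI_fixed f h l A P D tau sigma (xs, ss) ->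
   forall (x : X) (s : S),
     beta * sqnorm (inv_op P) (grad f x - grad f xs)
       <= dotp (x - xs) (grad f x - grad f xs) /\
     beta * sqnorm (inv_op (opM A P D tau sigma theta))
              (grad (conjugate l) s - grad (conjugate l) ss)
       <= dotp (s - ss) (grad (conjugate l) s - grad (conjugate l) ss)) ->
  tau < 2 * beta ->
  (forall k, iterI f h l A P D tau sigma (z k) (z k.+1)) ->
  exists zs : X * S,
    [/\ iterI_fixed f h l A P D tau sigma zs,
        weak_cvg z zs &
        demicompact (iterI_op f h l A P D tau sigma) 0 -> z @ \oo --> zs].
Proof.
move=> Abd _ _ _ _ tau0 sigma0 /andP[th1 th2] [_ _ fc] [hp _ _] [lp _ _] fs ls Ppd M1pd.
move=> [c cfix] beta0 coco tau2 zstep.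
have [kappa kappa0 fejer] := fejer_step Abd Ppd tau0 sigma0 th1 th2 M1pd beta0 tau2 coco.
have th12 : 2^-1 <= theta by lra.
have Npd := pos_def_opM Abd Ppd sigma0 M1pd th12.
set N := opM _ _ _ _ _ _ in Npd.
pose V v k := energy A P D tau sigma ((z k).1 - v.1) ((z k).2 - v.2).
have V0 v k : 0 <= V v k by rewrite addr_ge0 // pos_def_ge0.
have Vdec v (vfix : iterI_fixed f h l A P D tau sigma v) k := fejer v _ _ vfix (zstep k).
have Vcvg v : iterI_fixed f h l A P D tau sigma v -> cvgn (V v).
  move=> vfix; apply: nonincreasing_is_cvgn; last by exists 0 => _ [k _ <-].
  apply/nonincreasing_seqP => k; apply: le_trans (Vdec v vfix k).
  by rewrite lerDl mulr_ge0 ?(ltW kappa0) // !addr_ge0 ?sqr_ge0.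
have [[_ _ [p p0 pP]] [_ _ [n n0 nP]]] := (Ppd, Npd).
have VE v k : p * `|(z k).1 - v.1| ^+ 2 + n * `|(z k).2 - v.2| ^+ 2 <= V v k.
  by apply: lerD.
have V_le k : V c k <= V c 0%N.
  elim: k => // k; apply: le_trans; apply: le_trans (Vdec c cfix k).
  by rewrite lerDl mulr_ge0 ?(ltW kappa0) // !addr_ge0 ?sqr_ge0.
have sq_le r : r <= 1 + r ^+ 2 :> R by have := sqr_ge0 (r - 1); rewrite sqrrB1; nra.
have [b b1 b2] : exists2 b, forall k, `|(z k).1| <= b & forall k, `|(z k).2| <= b.
  exists (`|c.1| + `|c.2| + (1 + V c 0%N / p + V c 0%N / n)) => k.
    rewrite -[(z k).1](subrK c.1) addrC; apply: le_trans (ler_normD _ _) _.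
    rewrite -!addrA lerD2l (le_trans (sq_le _)) // ler_wpDl // lerD2l.
    rewrite ler_wpDr ?divr_ge0 ?(ltW n0) //.
    rewrite ler_pdivlMr // mulrC (le_trans _ (V_le k)) // (le_trans _ (VE c k)) //.
    by rewrite lerDl mulr_ge0 ?sqr_ge0 ?(ltW n0).
  rewrite -[(z k).2](subrK c.2) addrC; apply: le_trans (ler_normD _ _) _.
  rewrite -addrA ler_wpDl // lerD2l (le_trans (sq_le _)) //.
  rewrite -addrA lerD2l ler_wpDl ?divr_ge0 ?(ltW p0) //.
  rewrite ler_pdivlMr // mulrC (le_trans _ (V_le k)) // (le_trans _ (VE c k)) //.
  by rewrite lerDr mulr_ge0 ?sqr_ge0 ?(ltW p0).
(* Every quantity controlled by the energy decrease tends to 0. *)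
have vanish (E : hilbertType R) (u : nat -> E) : (forall k, `|u k| ^+ 2 <=
    `|grad f (z k).1 - grad f c.1| ^+ 2 + `|adjoint A ((z k).2 - c.2)| ^+ 2 +
    `|(z k).2 - (z k.+1).2| ^+ 2 +
    `|grad (conjugate l) (z k).2 - grad (conjugate l) c.2| ^+ 2) ->
    u k @[k --> \oo] --> 0.
  move=> uP; apply: (@fejer_cvg0 _ _ (V c) u kappa) => // k.
  by apply: le_trans (Vdec c cfix k); rewrite lerD2l ler_wpM2l ?(ltW kappa0).
have sq0 (E : hilbertType R) (e : E) : 0 <= `|e| ^+ 2 by exact: sqr_ge0.
have g0 : grad f (z k).1 - grad f c.1 @[k --> \oo] --> 0.
  by apply: vanish => k; rewrite -!addrA lerDl !addr_ge0.
have B0 : adjoint A ((z k).2 - c.2) @[k --> \oo] --> 0.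
  by apply: vanish => k; rewrite -!addrA ler_wpDl // lerDl !addr_ge0.
have d2 : (z k).2 - (z k.+1).2 @[k --> \oo] --> 0.
  by apply: vanish => k; rewrite -addrA ler_wpDl ?lerDl ?addr_ge0.
have w0 : grad (conjugate l) (z k).2 - grad (conjugate l) c.2 @[k --> \oo] --> 0.
  by apply: vanish => k; rewrite lerDr !addr_ge0.
have BS0 : adjoint A ((z k.+1).2 - c.2) @[k --> \oo] --> 0.
  by have := B0; rewrite -cvg_shiftS.
have [_ cx] := (fixed_stepE f h l A D Ppd tau0 sigma0 c).1 cfix.
have d1 : (z k).1 - (z k.+1).1 @[k --> \oo] --> 0.
  have -> : (fun k => (z k).1 - (z k.+1).1) = (fun k => tau *: inv_op P
      (grad f (z k).1 - grad f c.1 + adjoint A ((z k.+1).2 - c.2))).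
    apply/funext => k; rewrite ((stepE f h l A D Ppd tau0 sigma0 _ _).1 (zstep k)).2.
    by rewrite opprB addrC subrK (adjointB Abd) cx opprK addrACA subrr addr0.
  rewrite -(scaler0 _ tau); apply: cvgZr; apply: bounded_op_cvg0.
    by have [] := pos_def_inv_op Ppd.
  by rewrite -(addr0 0); exact: cvgD.
have [zs zsfix zweak] : exists2 zs, iterI_fixed f h l A P D tau sigma zs & weak_cvg z zs.
  apply: (opial Ppd Npd b1 b2 Vcvg) => F UF ooF x s x1 s2.
  have sub (W : hilbertType R) (u : nat -> W) (a : W) :
      u k - a @[k --> \oo] --> 0 -> u k @[k --> F] --> a.
    move=> ua; have {}ua : u k @[k --> \oo] --> a by apply: cvg_sub0 ua (cvg_cst _).
    by move=> U Ua; apply: ooF; exact: ua.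
  have sub0 (W : hilbertType R) (u : nat -> W) :
      u k @[k --> \oo] --> 0 -> u k @[k --> F] --> 0.
    by move=> u0 U U0; apply: ooF; exact: u0.
  apply: (weak_limit_fixed Abd Ppd tau0 sigma0 M1pd fc fs hp lp ls
    (u := z) (u' := fun k => z k.+1) (c := c) zstep b1 b2) => //.
  - exact: ultra_proper.
  - exact: (sub0 _ _ d1).
  - exact: (sub0 _ _ d2).
  - exact: (sub _ _ _ g0).
  - exact: (sub _ _ _ w0).
  - by apply: sub; under eq_fun do rewrite -(adjointB Abd).
exists zs; split => // demi.
(* The selected value of the iteration is the next iterate, by uniqueness. *)
have iterE k : iterI_op f h l A P D tau sigma (z k) = z k.+1.
  have th0 : 0 <= theta by lra.
  apply: (step_uniq Abd Ppd tau0 sigma0 th0 M1pd _ (zstep k)).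
  exact: (xgetPex 0 (ex_intro _ _ (zstep k))).
have [||phi phi_incr phi_cvg] := demi z.
- exists b; split => [|r br k _]; first exact: num_real.
  by apply: le_trans (ltW br); rewrite /= prod_normE ge_max b1 b2.
- have -> : (fun k => iterI_op f h l A P D tau sigma (z k) - z k) =
      (fun k => (- ((z k).1 - (z k.+1).1), - ((z k).2 - (z k.+1).2))).
    by apply/funext => k; rewrite iterE !opprB.
  by apply: cvg_pair; rewrite -oppr0; apply: cvgN.
have phi_oo := increasing_seq_cvg phi_incr.
have [y zy] : exists y : X * S, z (phi k) @[k --> \oo] --> y.
  by case/cvg_ex: phi_cvg => y zy; exists y.
have zy1 : (z (phi k)).1 @[k --> \oo] --> y.1 by apply: cvg_comp zy _; exact: cvg_fst.
have zy2 : (z (phi k)).2 @[k --> \oo] --> y.2 by apply: cvg_comp zy _; exact: cvg_snd.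
have yzs w : dotp y.1 w.1 + dotp y.2 w.2 = dotp zs.1 w.1 + dotp zs.2 w.2.
  apply: (cvg_unique (@norm_hausdorff _ _)
    (F := dotp (z (phi k)).1 w.1 + dotp (z (phi k)).2 w.2 @[k --> \oo])).
    by apply: cvgD; exact: cvg_dotpl.
  exact: cvg_comp phi_oo (zweak w).
have y1 : y.1 = zs.1.
  by apply: dotp_inj => v; have := yzs (v, 0); rewrite /= !dotp0r !addr0.
have y2 : y.2 = zs.2.
  by apply: dotp_inj => v; have := yzs (0, v); rewrite /= !dotp0r !add0r.
have Vphi : V zs (phi k) @[k --> \oo] --> (0 : R).
  have [[Pb _ _] [Nb _ _]] := (Ppd, Npd).
  rewrite -(addr0 (0 : R)); apply: cvgD; apply: sqnorm_cvg0 => //.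
    have -> : (0 : X) = y.1 - zs.1 by rewrite y1 subrr.
    by apply: cvgB => //; exact: cvg_cst.
  have -> : (0 : S) = y.2 - zs.2 by rewrite y2 subrr.
  by apply: cvgB => //; exact: cvg_cst.
(* [V zs] converges, so its limit can be read along the subsequence. *)
have V_0 : V zs k @[k --> \oo] --> (0 : R).
  have Vc := Vcvg zs zsfix.
  have Vphi' : V zs (phi k) @[k --> \oo] --> limn (V zs) by exact: cvg_comp phi_oo Vc.
  by rewrite -(cvg_unique (@norm_hausdorff _ _) Vphi' Vphi).
have z1 : (z k).1 - zs.1 @[k --> \oo] --> 0.
  apply: (sqr_norm_le_cvg0 (a := fun k => V zs k / p)) => [k|].
    rewrite ler_pdivlMr // mulrC (le_trans _ (VE zs k)) //.
    by rewrite lerDl mulr_ge0 ?(ltW n0).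
  by rewrite -(mul0r p^-1); apply: cvgM => //; exact: cvg_cst.
have z2 : (z k).2 - zs.2 @[k --> \oo] --> 0.
  apply: (sqr_norm_le_cvg0 (a := fun k => V zs k / n)) => [k|].
    rewrite ler_pdivlMr // mulrC (le_trans _ (VE zs k)) //.
    by rewrite lerDr mulr_ge0 ?(ltW p0).
  by rewrite -(mul0r n^-1); apply: cvgM => //; exact: cvg_cst.
have -> : z = (fun k => ((z k).1, (z k).2)).
  by apply/funext => k; rewrite -surjective_pairing.
rewrite (surjective_pairing zs).
by apply: cvg_pair; [apply: cvg_sub0 z1 _|apply: cvg_sub0 z2 _]; exact: cvg_cst.
Qed.
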